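(* The $f$-vector of any snake matroid base polytope is log-concave: if $P$ is the base polytope of a snake matroid, $d=\dim P$, and $f_i$ is the number of $i$-dimensional faces of $P$ for $0\le i\le d$, then $f_i^2\ge f_{i-1}f_{i+1}$ for all $0<i<d$.
   Context: A snake matroid is a matroid obtained from the uniform matroid $U_{1,2}$ (on the ordered ground set $\{1,2\}$) by repeatedly performing parallel or series extension at the maximum element: with $e$ the largest element of $E(M)$ and $e'$ a new largest element, the parallel extension has bases $\mathcal B(M)\cup\{B-e+e'\mid e\in B\in\mathcal B(M)\}$ and the series extension has bases $\{B+e'\mid B\in\mathcal B(M)\}\cup\{B+e\mid e\notin B\in\mathcal B(M)\}$. The base polytope of a matroid $M$ on $E$ is the convex hull in $\mathbb R^E$ of the vectors $e_B=\sum_{b\in B}e_b$, $B\in\mathcal B(M)$. The $f$-vector of a $d$-dimensional polytope is $(f_0,\dots,f_d)$ with $f_i$ the number of faces of dimension $i$ (so $f_d=1$). *)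

(* Defs.v *)
From mathcomp Require Import all_boot all_order all_algebra.

Set Implicit Arguments.
Unset Strict Implicit.
Unset Printing Implicit Defensive.

Record matroid (E : finType) := Matroid {
  bases : {set {set E}};
  bases_neq0 : bases != set0;
  bases_exchange : forall A B : {set E}, A \in bases -> B \in bases ->
    forall a, a \in A :\: B ->
    exists2 b, b \in B :\: A & b |: (A :\ a) \in bases }.

(* The ground set {1, .., n} is rendered by 'I_n with its natural order.  When
   'I_n.+1 is enlarged to 'I_n.+2, the old elements are embedded by
   [lift ord_max] (which preserves the value of an ordinal), and the new largest
   element is ord_max : 'I_n.+2. *)
Section Extensions.
Variable n : nat.

Definition up (B : {set 'I_n.+1}) : {set 'I_n.+2} := lift ord_max @: B.

Definition parallel_bases (BM : {set {set 'I_n.+1}}) : {set {set 'I_n.+2}} :=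
  [set up B | B in BM] :|:
  [set ord_max |: up (B :\ ord_max) | B in BM & ord_max \in B].

Definition series_bases (BM : {set {set 'I_n.+1}}) : {set {set 'I_n.+2}} :=
  [set ord_max |: up B | B in BM] :|:
  [set up (ord_max |: B) | B in BM & ord_max \notin B].

Local Notation e' := (ord_max : 'I_n.+2).
Local Notation m := (ord_max : 'I_n.+1).
Local Notation lft := (@lift n.+2 ord_max).

Lemma mem_up B i : (lft i \in up B) = (i \in B).
Proof. by rewrite mem_imset //; exact: lift_inj. Qed.

Lemma max_up B : (e' \in up B) = false.
Proof. by apply/imsetP => -[i _ /eqP]; rewrite (negbTE (neq_lift _ _)). Qed.

Lemma ord_maxVlift (i : 'I_n.+2) : i = e' \/ exists j, i = lft j.
Proof. by case: (unliftP ord_max i) => [j|] ->; [right; exists j | left]. Qed.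

Lemma lift_eq i j : (lft i == lft j) = (i == j).
Proof. exact/inj_eq/lift_inj. Qed.

Lemma lift_eq_max i : (lft i == e') = false.
Proof. by rewrite eq_sym (negbTE (neq_lift e' i)). Qed.

Lemma max_eq_lift i : (e' == lft i) = false.
Proof. exact: negbTE (neq_lift e' i). Qed.

Let E := (in_setU, in_setD, in_setD1, in_setU1, in_set1, mem_up, max_up, eqxx,
  lift_eq, lift_eq_max, max_eq_lift).

Lemma eq_set_up (X Y : {set 'I_n.+2}) :
  (e' \in X) = (e' \in Y) -> (forall i, (lft i \in X) = (lft i \in Y)) -> X = Y.
Proof.
by move=> h1 h2; apply/setP => i; case: (ord_maxVlift i) => [|[j]] ->.
Qed.

Let col (X : {set 'I_n.+2}) :=
  [set i | (lft i \in X) || ((i == m) && (e' \in X))].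
Let core (X : {set 'I_n.+2}) :=
  [set i | (lft i \in X) && ((i != m) || (e' \in X))].

Lemma parallelE BM X : (X \in parallel_bases BM) =
  ~~ ((lft m \in X) && (e' \in X)) && (col X \in BM).
Proof.
apply/idP/andP => [/setUP[/imsetP[B BB ->]|/imsetP[B]]|[fX cX]].
- rewrite !E andbF; split=> //; suff -> : col (up B) = B by [].
  by apply/setP => i; rewrite inE !E andbF orbF.
- rewrite inE => /andP[BB mB] ->; rewrite !E /=; split=> //.
  suff -> : col (e' |: up (B :\ m)) = B by [].
  by apply/setP => i; rewrite inE !E andbT /=; case: (eqVneq i m) => [->|]; rewrite ?mB ?orbF.
- apply/setUP; have [eX|eX] := boolP (e' \in X); [right|left]; apply/imsetP.
    exists (col X); first by rewrite inE cX inE eqxx eX orbT.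
    apply: eq_set_up => [|i]; first by rewrite !E eX.
    rewrite !E inE eX andbT /=; case: eqVneq fX => [->|] /=; last by rewrite orbF.
    by rewrite eX andbT => /negbTE.
  exists (col X) => //; apply: eq_set_up => [|i]; first by rewrite !E (negbTE eX).
  by rewrite !E inE (negbTE eX) andbF orbF.
Qed.

Lemma seriesE BM X : (X \in series_bases BM) =
  ((lft m \in X) || (e' \in X)) && (core X \in BM).
Proof.
apply/idP/andP => [/setUP[/imsetP[B BB ->]|/imsetP[B]]|[fX cX]].
- rewrite !E orbT; split=> //; suff -> : core (e' |: up B) = B by [].
  by apply/setP => i; rewrite inE !E /= orbT andbT.
- rewrite inE => /andP[BB mB] ->; rewrite !E /=; split=> //.
  suff -> : core (up (m |: B)) = B by [].
  apply/setP => i; rewrite inE !E /= orbF.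
  by case: (eqVneq i m) => [->|]; rewrite ?(negbTE mB) ?andbT ?andbF.
- apply/setUP; have [eX|eX] := boolP (e' \in X); [left|right]; apply/imsetP.
    exists (core X) => //; apply: eq_set_up => [|i]; first by rewrite !E eX.
    by rewrite !E inE eX orbT andbT.
  exists (core X); first by rewrite !inE cX eqxx (negbTE eX) andbF.
  apply: eq_set_up => [|i]; first by rewrite !E (negbTE eX).
  rewrite !E inE (negbTE eX) orbF.
  case: eqVneq fX => [->|] /=; last by rewrite andbT.
  by rewrite (negbTE eX) orbF.
Qed.

Variable M : matroid 'I_n.+1.

Lemma parallel_neq0 : parallel_bases (bases M) != set0.
Proof.
have /set0Pn[B BB] := bases_neq0 M.
by apply/set0Pn; exists (up B); apply/setUP; left; apply/imsetP; exists B.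
Qed.

Lemma series_neq0 : series_bases (bases M) != set0.
Proof.
have /set0Pn[B BB] := bases_neq0 M.
by apply/set0Pn; exists (e' |: up B); apply/setUP; left; apply/imsetP; exists B.
Qed.

Lemma parallel_exchange A B :
    A \in parallel_bases (bases M) -> B \in parallel_bases (bases M) ->
  forall a, a \in A :\: B ->
  exists2 b, b \in B :\: A & b |: (A :\ a) \in parallel_bases (bases M).
Proof.
rewrite !parallelE => /andP[fA cA] /andP[fB cB] a; rewrite inE => /andP[aB aA].
pose p := if unlift e' a is Some j then j else m.
have pA : p \in col A.
  rewrite /p inE; case: unliftP aA => [j|] -> => [->//|aA].
  by rewrite eqxx aA orbT.
have [pB|pB] := boolP (p \in col B).
  case: (ord_maxVlift a) => [|[j]] aE; rewrite {}aE ?unlift_none ?liftK in p pA pB aA aB *.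
    exists (lft m).
      move: pB fA; rewrite /p inE (negbTE aB) !E aA andbF orbF andbT.
      by move=> -> ->.
    rewrite parallelE !E /=.
    suff -> : col (lft m |: A :\ e') = col A by [].
    by apply/setP => i; rewrite !inE !E /= aA andbF orbF andbT orbC.
  have jm : j = m.
    by apply/eqP; move: pB; rewrite /p inE (negbTE aB) => /andP[].
  subst j; exists e'.
    move: pB fA; rewrite /p inE (negbTE aB) eqxx /= !E aA /=.
    by move=> -> ->.
  rewrite parallelE !E /=.
  suff -> : col (e' |: A :\ lft m) = col A by [].
  apply/setP => i; rewrite !inE !E /=.
  by case: eqVneq => [->|]; rewrite ?aA.
have pAB : p \in col A :\: col B by rewrite inE pB.
have [q qBA qM] := bases_exchange cA cB pAB.
move: qBA; rewrite inE => /andP[qA qB].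
have [b bB bE] : exists2 b, b \in B & q = (if unlift e' b is Some j then j else m).
  move: qB; rewrite inE => /orP[qB|/andP[/eqP-> eB]].
    by exists (lft q); rewrite ?liftK.
  by exists e'; rewrite ?unlift_none.
have bA : b \notin A.
  apply: contra qA => bA; rewrite bE inE.
  by case: unliftP bA => [j|] -> => [->//|->]; rewrite eqxx orbT.
exists b; first by rewrite inE bA.
rewrite parallelE.
have -> : col (b |: A :\ a) = q |: col A :\ p.
  apply/setP => i; rewrite !inE; move: fA qA; rewrite bE /p inE.
  case: (ord_maxVlift a) aA => [|[j]] -> aA; case: (ord_maxVlift b) bA => [|[k]] -> bA;
    rewrite ?unlift_none ?liftK ?E ?aA /= ?(negbTE bA) ?E /= ?andbT ?andbF ?orbF ?orbT //.
  - by move=> mA _; case: (eqVneq i m) => [->|]; rewrite ?(negbTE mA) /= ?orbF.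
  - by rewrite orbC.
  - move=> fA _; case: (eqVneq i m) => [->|]; rewrite /= ?orbF //.
    case: (eqVneq m j) aA fA => [<-|_] aA; last by rewrite orbA.
    by rewrite aA /= => /negbTE ->; rewrite orbF.
rewrite qM andbT !E; move: fA qA; rewrite bE inE.
case: (ord_maxVlift b) => [|[k]] ->; rewrite ?unlift_none ?liftK ?E ?eqxx /=.
  by move=> _ /norP[/negbTE-> _]; rewrite andbF.
case: (eqVneq m k) => [<-|mk] /=.
  by move=> _ /norP[_ /negbTE->]; rewrite andbF.
by move=> /nandP[/negbTE->|/negbTE->] _; rewrite ?andbF.
Qed.

Lemma series_exchange A B :
    A \in series_bases (bases M) -> B \in series_bases (bases M) ->
  forall a, a \in A :\: B ->
  exists2 b, b \in B :\: A & b |: (A :\ a) \in series_bases (bases M).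
Proof.
rewrite !seriesE => /andP[fA cA] /andP[fB cB] a; rewrite inE => /andP[aB aA].
pose p := if unlift e' a is Some j then j else m.
have pB : p \notin core B.
  rewrite /p inE; case: unliftP aB => [j|] -> => [/negbTE ->//|/negbTE ->].
  by rewrite eqxx andbF.
have [pA|pA] := boolP (p \in core A); last first.
  case: (ord_maxVlift a) => [|[j]] aE; rewrite {}aE ?unlift_none ?liftK in p pA pB aA aB *.
    move: pA fB; rewrite /p inE aA orbT andbT (negbTE aB) orbF => pA fB.
    exists (lft m); first by rewrite inE pA.
    rewrite seriesE !E /=; suff -> : core (lft m |: A :\ e') = core A by [].
    apply/setP => i; rewrite !inE !E /= aA orbT andbT orbF.
    by case: eqVneq => [->|]; rewrite ?(negbTE pA) ?andbF ?andbT.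
  move: pA; rewrite /p inE aA /= negb_or negbK => /andP[/eqP jm eA].
  subst j; move: fB; rewrite (negbTE aB) /= => fB.
  exists e'; first by rewrite inE eA.
  rewrite seriesE !E /=; suff -> : core (e' |: A :\ lft m) = core A by [].
  apply/setP => i; rewrite !inE !E /= (negbTE eA) orbT orbF andbT.
  by case: eqVneq => [->|]; rewrite ?andbF ?andbT.
have pAB : p \in core A :\: core B by rewrite inE pB.
have [q qBA qM] := bases_exchange cA cB pAB.
move: qBA; rewrite inE => /andP[qA qB].
have [qm|qm] := eqVneq q m; last first.
  exists (lft q).
    by move: qA qB; rewrite !inE qm !andbT => -> ->.
  rewrite seriesE !E /=; apply/andP; split.
    move: fA pA; rewrite /p inE.
    case: (ord_maxVlift a) aA => [|[j]] -> aA; rewrite ?unlift_none ?liftK ?E /=.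
      by move=> _; rewrite ?eqxx => /andP[->]; rewrite orbT.
    rewrite aA /=; case: (eqVneq m j) => [_|_] /=.
      by move=> _ ->; rewrite !orbT.
    by move=> /orP[->|->] _; rewrite !orbT.
  suff -> : core (lft q |: A :\ a) = q |: core A :\ p by [].
  apply/setP => i; rewrite !inE; move: pA; rewrite /p inE.
  case: (ord_maxVlift a) aA => [|[j]] -> aA; rewrite ?unlift_none ?liftK ?E /= ?aA /=.
    move=> _; case: (eqVneq i q) => [->|] /=; first by rewrite qm.
    by case: (eqVneq i m); rewrite /= ?andbF ?andbT.
  move=> h; case: (eqVneq i q) => [->|] /=; first by rewrite qm.
  by rewrite andbA.
subst q; move: qA qB pA; rewrite !inE eqxx /= => qA /andP[mB eB] pA.
have pm : p != m.
  by apply: contraNneq qA => pm; move: pA; rewrite pm eqxx.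
have aE : a = lft p.
  by move: pm; rewrite /p; case: unliftP => [j ->//|_]; rewrite eqxx.
move: aA aB; rewrite {}aE => aA aB.
have {}pA : p != m by [].
have mp : m != p by rewrite eq_sym.
have [eA|eA] := boolP (e' \in A).
  have mA : lft m \notin A by move: qA; rewrite eA andbT.
  exists (lft m); first by rewrite inE mA.
  rewrite seriesE !E /=; suff -> : core (lft m |: A :\ lft p) = m |: core A :\ p by [].
  apply/setP => i; rewrite !inE !E /= eA !orbT !andbT.
  by case: (eqVneq i m).
have mA : lft m \in A by move: fA; rewrite (negbTE eA) orbF.
exists e'; first by rewrite inE eA.
rewrite seriesE !E /= orbT; suff -> : core (e' |: A :\ lft p) = m |: core A :\ p by [].
apply/setP => i; rewrite !inE !E /= (negbTE eA) orbF orbT andbT.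
by case: (eqVneq i m) => [->|]; rewrite ?mp ?mA ?andbT.
Qed.
End Extensions.

Definition parallel_ext n (M : matroid 'I_n.+1) : matroid 'I_n.+2 :=
  Matroid (parallel_neq0 M) (@parallel_exchange n M).

Definition series_ext n (M : matroid 'I_n.+1) : matroid 'I_n.+2 :=
  Matroid (series_neq0 M) (@series_exchange n M).

Definition U12_bases : {set {set 'I_2}} :=
  [set B : {set 'I_2} | #|B| == 1].

Lemma U12_neq0 : U12_bases != set0.
Proof. by apply/set0Pn; exists [set ord0]; rewrite inE cards1. Qed.

Lemma U12_exchange (A B : {set 'I_2}) : A \in U12_bases -> B \in U12_bases ->
  forall a, a \in A :\: B ->
  exists2 b, b \in B :\: A & b |: (A :\ a) \in U12_bases.
Proof.
rewrite !inE => /cards1P[x ->] /cards1P[y ->] a.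
rewrite !inE => /andP[ay /eqP ax]; exists y; first by rewrite !inE -ax eq_sym ay /=.
by rewrite ax setDv setU0 inE cards1.
Qed.

Definition U12 : matroid 'I_2 := Matroid U12_neq0 U12_exchange.

Inductive snake : forall n, matroid 'I_n -> Prop :=
| snake_U12 : snake U12
| snake_parallel n (M : matroid 'I_n.+1) : snake M -> snake (parallel_ext M)
| snake_series n (M : matroid 'I_n.+1) : snake M -> snake (series_ext M).

(* Required only here: classical_sets overrides the {set T} notations used above. *)
From mathcomp Require Import finmap all_classical all_reals convex.
Import GRing.Theory.
Local Open Scope classical_set_scope.
Local Open Scope ring_scope.

Section Polytopes.
Variables (R : realType) (n : nat).
Local Notation V := 'rV[R]_n.

Definition convex_hull (A : set V) : set V := smallest (@convex_set R V) A.

Definition affine_set (A : set V) : Prop :=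
  forall (x y : V) (t : R), A x -> A y -> A (t *: x + (1 - t) *: y).

Definition affine_hull (A : set V) : set V := smallest affine_set A.

(* The dimension of a set is that of its affine hull.  The empty set has no
   dimension in this sense, hence is never counted as a face below. *)
Definition has_dim (A : set V) (d : nat) : Prop :=
  exists (x : V) (U : {vspace V}),
    affine_hull A = [set x + u | u in [set u | u \in U]] /\ \dim U = d.

Definition dot (c x : V) : R := \sum_i c 0 i * x 0 i.

(* Taking c = 0 shows that P is a face of itself. *)
Definition is_face (P F : set V) : Prop :=
  exists (c : V) (b : R),
    (forall x, P x -> dot c x <= b) /\ F = P `&` [set x | dot c x = b].

(* fset_set is the underlying finite set of a finite classical set (and is empty
   on infinite ones); a polytope has finitely many faces. *)
Definition fvec (P : set V) (i : nat) : nat :=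
  #|` fset_set [set F | is_face P F /\ has_dim F i]|%fset.

Definition indicator_vec (B : {set 'I_n}) : V := \sum_(b in B) delta_mx 0 b.

Definition base_polytope (M : matroid 'I_n) : set V :=
  convex_hull [set indicator_vec B | B in [set` bases M]].

End Polytopes.
Arguments base_polytope R {n} M.

(* Main.v *)
Require Import Defs.
From mathcomp Require Import all_boot all_order all_algebra.
From mathcomp Require Import ring lra.
From mathcomp Require Import boolp reals.

(** Let [e] be the largest element and call a nonempty face of the base polytope
    avoiding, or containing, when none, or all, of its bases contain [e].

    A face is the convex hull of the bases of maximal weight for some weight [c]
    on the ground set, so faces can be counted as families of bases.  In a
    parallel extension every basis through [e] splits into two bases, one through
    [e] and one through the new element [e'].  A weight on the extension amounts
    to a weight on the original matroid, together with a comparison of [e] with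
    [e'].  Hence an avoiding face yields one face, of the same dimension, and
    any other face [S] yields three: keep [e], replace it by [e'], or take both,
    the last one gaining the direction [e' - e].  With [f], [a], [b] the
    generating polynomials by dimension of all, avoiding and containing faces,
      [f -> f + (1 + t) (f - a)],   [a -> f],   [b -> b].
    A series extension is the same operation read on complements of bases; these
    have the same faces and exchange [a] with [b].  In terms of [p = f - a] and
    [q = f - b] the step is
      [(p, q, f) -> ((1 + t) p, q + (1 + t) p, f + (1 + t) p)]
    up to exchanging [p] with [q] ([face_family_parallel], [card_faces_parallel],
    [series_bases_dual]).  The starting point is the loopless matroid on one
    element, whose parallel extension is [U_{1,2}].

    Log-concavity of [f] says that [f_i f_j >= f_(i-1) f_(j+1)] for [i <= j],
    that is, the ratios of the coefficients of [t f] to those of [f] increase.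
    It is not preserved by the step on its own.  The property [interlaced]
    strengthens it to a system of comparisons of this kind between [p], [q], [f],
    their shifts and their multiples by [1 + t].  Each comparison is bilinear,
    and is preserved by multiplying both sides by [1 + t]; this is enough to
    derive the system after the step from the system before it
    ([interlaced_step]).  The delicate point: the polynomials
    [(1 + t) p - t q] and [(1 + t) p - t f] do not change when [p] is the component
    that is multiplied, and where term-by-term comparison fails, the offending
    terms cancel into one of these.

    On the geometric side, the face exposed by a functional lies in the affine
    span of its vertices because the set of points that are either strictly
    below the maximum or in that span is convex and contains every vertex
    ([polytope_exposed]).  So faces correspond to maximizing families, and their
    dimension is that of the span of differences of indicator vectors
    ([fvec_base_polytope]). *)

Set Implicit Arguments.
Unset Strict Implicit.
Unset Printing Implicit Defensive.
Import Order.TTheory GRing.Theory Num.Theory.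
Local Open Scope ring_scope.

(** * Ratio comparisons of coefficient sequences *)

Section RatioComparisons.

Local Notation t := ('X : {poly int}).
Local Notation x := (1 + 'X : {poly int}).

(** When [u] is positive this says that [v`_i / u`_i] increases with [i].  The
    cross-multiplied form is bilinear and makes sense for any signs. *)
Definition ratio_le (u v : {poly int}) : Prop :=
  forall i j, (i < j)%N -> u`_j * v`_i <= u`_i * v`_j.

(** Comparing with every shift of [v] at once spares any appeal to transitivity
    of [ratio_le], which fails when coefficients vanish. *)
Definition shifts_le (u v : {poly int}) : Prop :=
  forall k, ratio_le u ('X^k * v).

Lemma ratio_leDl u1 u2 v : ratio_le u1 v -> ratio_le u2 v -> ratio_le (u1 + u2) v.
Proof. by move=> h1 h2 i j ij; rewrite !coefD !mulrDl lerD ?h1 ?h2. Qed.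

Lemma ratio_leDr u v1 v2 : ratio_le u v1 -> ratio_le u v2 -> ratio_le u (v1 + v2).
Proof. by move=> h1 h2 i j ij; rewrite !coefD !mulrDr lerD ?h1 ?h2. Qed.

Lemma ratio_le_refl u : ratio_le u u.
Proof. by move=> i j _; rewrite mulrC. Qed.

Lemma ratio_le_addr u v : ratio_le u v -> ratio_le u (u + v).
Proof. by apply: ratio_leDr; exact: ratio_le_refl. Qed.

Lemma ratio_le_subr u v : ratio_le v u -> ratio_le u (u - v).
Proof. by move=> h i j /h; rewrite !coefB; lra. Qed.

Lemma ratio_leX u v : ratio_le u v -> ratio_le (t * u) (t * v).
Proof. by move=> h [|i] [|j] // ij; rewrite !coefXM /= ?mul0r ?mulr0 //; exact: h. Qed.

(** A minor of [(x * u, x * v)] is a sum of four minors of [(u, v)]; for adjacent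
    columns one of the four vanishes, and the others have the right sign. *)
Lemma ratio_leM1X u v : ratio_le u v -> ratio_le (x * u) (x * v).
Proof.
move=> h [|i] [|j] // ij; rewrite !mulrDl !mul1r !coefD !coefXM /=.
  by have := h 0 j.+1 ij; case: j ij => [|j] ij; [lra | have := h 0 j.+1 isT; lra].
have h1 := h i.+1 j.+1 ij; have h2 := h i j ij.
have h3 := h i j.+1 (ltnW ij); move: ij; rewrite ltnS leq_eqVlt => /orP[/eqP ij|ij].
  by move: h1 h2 h3; rewrite -ij; lra.
by have := h i.+1 j ij; lra.
Qed.

Lemma shifts_leP u v : ratio_le u v -> shifts_le u (t * v) -> shifts_le u v.
Proof. by move=> h0 h [|k]; [rewrite mul1r | rewrite exprSr -mulrA; exact: h]. Qed.

Lemma shifts_le_ratio u v : shifts_le u v -> ratio_le u v.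
Proof. by move=> /(_ 0); rewrite mul1r. Qed.

Lemma shifts_leDl u1 u2 v :
  shifts_le u1 v -> shifts_le u2 v -> shifts_le (u1 + u2) v.
Proof. by move=> h1 h2 k; apply: ratio_leDl. Qed.

Lemma shifts_leDr u v1 v2 :
  shifts_le u v1 -> shifts_le u v2 -> shifts_le u (v1 + v2).
Proof. by move=> h1 h2 k; rewrite mulrDr; apply: ratio_leDr. Qed.

Lemma shifts_le_Xr u v : shifts_le u v -> shifts_le u (t * v).
Proof. by move=> h k; rewrite mulrA -exprSr. Qed.

Lemma shifts_le_1Xr u v : shifts_le u v -> shifts_le u (x * v).
Proof. by move=> h; rewrite mulrDl mul1r; apply/shifts_leDr/shifts_le_Xr. Qed.

Lemma shifts_leX u v : shifts_le u v -> shifts_le (t * u) (t * v).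
Proof. by move=> h k; rewrite mulrCA; apply: ratio_leX. Qed.

Lemma shifts_leM1X u v : shifts_le u v -> shifts_le (x * u) (x * v).
Proof. by move=> h k; rewrite mulrCA; apply: ratio_leM1X. Qed.

Lemma shifts_le_refl u : shifts_le u (t * u) -> shifts_le u u.
Proof. by apply: shifts_leP; exact: ratio_le_refl. Qed.

(** The comparisons that survive an extension step, stated asymmetrically so that
    the exchange of [p] and [q] comes for free.  The first two clauses say that
    [p] is log-concave and compare it with [q].  The left-hand sides of the
    next two do not change in a step that multiplies [p] by [x]; they may have
    negative coefficients. *)
Definition half_interlaced (p q f : {poly int}) : Prop :=
  [/\ shifts_le p (t * p) /\ shifts_le p (t * q), shifts_le (x * p) (t * q),
      shifts_le (x * p - t * q) (x * p), shifts_le (x * p - t * f) (x * p)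
    & shifts_le f (t * p)].

Definition interlaced (p q f : {poly int}) : Prop :=
  [/\ half_interlaced p q f, half_interlaced q p f & ratio_le f (t * f)].

Lemma interlaced_sym p q f : interlaced p q f -> interlaced q p f.
Proof. by case. Qed.

(** Here the component multiplied by [x] is in first position. *)
Lemma half_interlaced_grow p q f :
  half_interlaced p q f -> half_interlaced (x * p) (q + x * p) (f + x * p).
Proof.
move=> [[pp pq] xpq D G fp].
have xpp : shifts_le (x * p) (t * (x * p)) by rewrite mulrCA; apply: shifts_leM1X.
have xptq := shifts_le_Xr xpq.
split; rewrite ?[t * (_ + _)]mulrDr.
- by split=> //; apply: shifts_leDr.
- (* Before any shift, [x (x p)] against [t q] leaves a term of the wrong sign,
     which [t (x p)] absorbs through the invariant [x p - t q].  Proper shifts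
     compare termwise. *)
  apply: shifts_leP.
    have -> : t * q + t * (x * p) = x * (x * p) - (x * p - t * q) by ring.
    by apply: ratio_le_subr; apply: shifts_le_ratio; apply: shifts_le_1Xr.
  rewrite mulrDr {1}[x * (x * p)]mulrDl mul1r.
  apply: shifts_leDr; apply: shifts_leDl => //; last exact: shifts_leX.
  + exact: shifts_leX.
  + exact: shifts_le_Xr.
- have -> : x * (x * p) - (t * q + t * (x * p)) = x * p - t * q by ring.
  exact: shifts_le_1Xr.
- have -> : x * (x * p) - (t * f + t * (x * p)) = x * p - t * f by ring.
  exact: shifts_le_1Xr.
- by apply: shifts_leDl => //; rewrite mulrCA; apply: shifts_le_1Xr.
Qed.

(** Here the component multiplied by [x] is in second position, so both halves
    of the previous system are needed. *)
Lemma half_interlaced_mix p q f :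
    half_interlaced p q f -> half_interlaced q p f ->
  half_interlaced (q + x * p) (x * p) (f + x * p).
Proof.
move=> [[pp pq] xpq _ G fp] [[qq qp] xqp _ H fq].
have xpp : shifts_le (x * p) (t * (x * p)) by rewrite mulrCA; apply: shifts_leM1X.
have xqq : shifts_le (x * q) (t * (x * q)) by rewrite mulrCA; apply: shifts_leM1X.
have xq_xp : shifts_le (x * q) (t * (x * p)) by rewrite mulrCA; apply: shifts_leM1X.
have xp_xq : shifts_le (x * p) (t * (x * q)) by rewrite mulrCA; apply: shifts_leM1X.
have q_xp : shifts_le q (t * (x * p)) by rewrite mulrCA; apply: shifts_le_1Xr.
have p_xp : shifts_le p (t * (x * p)) by rewrite mulrCA; apply: shifts_le_1Xr.
have f_xp : shifts_le f (t * (x * p)) by rewrite mulrCA; apply: shifts_le_1Xr.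
split; rewrite ?[t * (_ + _)]mulrDr.
- by split; [apply: shifts_leDr|]; apply: shifts_leDl.
- rewrite mulrDr; apply: shifts_leDl => //.
  rewrite {1}[x * (x * p)]mulrDl mul1r; apply: shifts_leDl => //.
  exact/shifts_leX/shifts_le_refl.
- have -> : x * (q + x * p) - t * (x * p) = x * (q + p) by ring.
  apply: shifts_leM1X; apply: shifts_leP.
    have -> : q + x * p = q + p + t * p by ring.
    by apply/ratio_le_addr/shifts_le_ratio/shifts_leDl.
  by rewrite mulrDr; apply: shifts_leDl; apply: shifts_leDr.
- have GH : x * (q + x * p) - (t * f + t * (x * p)) = x * q - t * f + x * p by ring.
  (* The new polynomial is both [(x q - t f) + x p] and [(x p - t f) + x q]; each
     form is compared with the part of the target that suits it. *)
  rewrite {}GH; apply: shifts_leP.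
    rewrite mulrDr => i j ij.
    have h1 := shifts_le_ratio H ij.
    have h2 := shifts_le_ratio (shifts_le_1Xr G) ij.
    have h3 := shifts_le_ratio xq_xp ij.
    move: h1 h2 h3; set P := x * p; set Q := x * q.
    rewrite mulrDl mul1r !(coefB, coefD); lra.
  rewrite mulrDr mulrDr; apply: shifts_leDr.
    by apply: shifts_leDl => //; exact: shifts_le_Xr.
  have -> : x * q - t * f + x * p = x * p - t * f + x * q by ring.
  by rewrite mulrCA; apply: shifts_leDl; apply: shifts_le_1Xr => //; exact: shifts_le_Xr.
- by apply: shifts_leDl; apply: shifts_leDr.
Qed.

Lemma interlaced_step p q f :
  interlaced p q f -> interlaced (x * p) (q + x * p) (f + x * p).
Proof.
move=> [hp hq ff]; split; [exact: half_interlaced_grow|exact: half_interlaced_mix|].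
have [[pp _] _ _ G fp] := hp.
rewrite mulrDr; apply: ratio_leDl; apply: ratio_leDr => //.
- by rewrite mulrCA; apply/shifts_le_ratio/shifts_le_1Xr.
- have -> : t * f = x * p - (x * p - t * f) by ring.
  exact/ratio_le_subr/shifts_le_ratio.
- by rewrite mulrCA; apply/ratio_leM1X/shifts_le_ratio.
Qed.

Lemma interlaced_base : interlaced 1 0 1.
Proof.
have u0 u : shifts_le u 0 by move=> k i j _; rewrite mulr0 !coef0 !mulr0.
have o1 k : ratio_le 1 'X^k.
  move=> i j ij; rewrite !coef1 !coefXn; case: j ij => // j _.
  by rewrite mul0r mulr_ge0 ?ler0n.
have one : shifts_le 1 (t * 1) by move=> k; rewrite mulr1 -exprSr.
have xx : shifts_le x x.
  by rewrite -[x]mulr1; apply/shifts_leM1X/shifts_le_refl.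
rewrite mulr1 in one.
split; last by rewrite mulr1; exact: (o1 1%N).
  split; rewrite ?mulr0 ?subr0 ?mulr1 //.
  have -> : x - t = 1 by ring.
  by rewrite -[x]mulr1; apply/shifts_le_1Xr/shifts_le_refl; rewrite mulr1.
have z u : shifts_le 0 u by move=> k i j _; rewrite !coef0 !mul0r.
by split; rewrite ?mulr0.
Qed.

End RatioComparisons.

(** * Families of sets and their faces *)

Section Families.
Variable R : realType.

Section OneFamily.
Variable n : nat.
Implicit Types (F S : {set {set 'I_n}}) (B C : {set 'I_n}) (c : 'I_n -> R).

Definition weight c B : R := \sum_(i in B) c i.

Definition maximizers c F : {set {set 'I_n}} :=
  [set B in F | [forall C in F, weight c C <= weight c B]].

(** A face is encoded by the set of its vertices, as a family of ground subsets. *)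
Definition face_family F S : bool := `[< exists c, S = maximizers c F >].

(** All pairs of members are used, so that no base point has to be chosen; for a
    nonempty family this is the direction of the affine span. *)
Definition direction S : {vspace 'rV[R]_n} :=
  (\sum_(B in S) \sum_(C in S) <[indicator_vec R B - indicator_vec R C]>)%VS.

Definition faces F i : {set {set {set 'I_n}}} :=
  [set S | face_family F S && (\dim (direction S) == i)].

Lemma maximizersP c F B :
  reflect (B \in F /\ forall C, C \in F -> weight c C <= weight c B)
          (B \in maximizers c F).
Proof. by rewrite inE; apply: (iffP andP) => -[? /forall_inP]. Qed.

Lemma maximizers_neq0 c F : F != set0 -> maximizers c F != set0.
Proof.
case/set0Pn => B FB; apply/set0Pn.
have [C FC Cmax] := arg_maxP (weight c) FB.
by exists C; apply/maximizersP; split => // D /Cmax.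
Qed.

Lemma eq_maximizers c d F : c =1 d -> maximizers c F = maximizers d F.
Proof. by move=> /funext->. Qed.

Lemma mem_direction S B C :
  B \in S -> C \in S -> indicator_vec R B - indicator_vec R C \in direction S.
Proof.
move=> SB SC; rewrite memvE.
by apply: (sumv_sup B) => //; apply: (sumv_sup C).
Qed.

Lemma direction_subP S (U : {vspace 'rV[R]_n}) :
    (forall B C, B \in S -> C \in S ->
      indicator_vec R B - indicator_vec R C \in U) ->
  (direction S <= U)%VS.
Proof.
by move=> h; apply/subv_sumP => B SB; apply/subv_sumP => C SC; rewrite -memvE h.
Qed.

Lemma dim_direction_le S : (\dim (direction S) <= n)%N.
Proof. by have := dimvS (subvf (direction S)); rewrite dimvf dim_matrix mul1r. Qed.

End OneFamily.

(** * Relabelling along injections *)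

Section Relabel.
Variables (m n : nat) (g : 'I_m -> 'I_n).
Hypothesis g_inj : injective g.

Definition relabel (S : {set {set 'I_m}}) : {set {set 'I_n}} :=
  [set g @: B | B : {set 'I_m} in S].

Definition relabel_mx : 'M[R]_(m, n) := \matrix_(i, j) (j == g i)%:R.

Lemma relabel_inj : injective relabel.
Proof. exact/imset_inj/imset_inj. Qed.

Lemma mem_relabel S (B : {set 'I_m}) : (g @: B \in relabel S) = (B \in S).
Proof. by rewrite mem_imset //; apply: imset_inj. Qed.

Lemma weight_relabel c (B : {set 'I_m}) : weight c (g @: B) = weight (c \o g) B.
Proof. by rewrite /weight big_imset //= => i j _ _; apply: g_inj. Qed.

Lemma indicator_relabel (B : {set 'I_m}) :
  indicator_vec R (g @: B) = indicator_vec R B *m relabel_mx.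
Proof.
rewrite /indicator_vec mulmx_suml big_imset /=; last by move=> i j _ _; apply: g_inj.
apply: eq_bigr => i _; rewrite -rowE; apply/rowP => j.
by rewrite !mxE.
Qed.

Lemma relabel_mxK : relabel_mx *m relabel_mx^T = 1%:M.
Proof.
apply/matrixP => i k; rewrite !mxE (bigD1 (g i)) //= big1 => [|j jg].
  by rewrite !mxE eqxx mul1r addr0 (inj_eq g_inj).
by rewrite !mxE (negbTE jg) mul0r.
Qed.

Definition relabel_hom : 'Hom('rV[R]_m, 'rV[R]_n) := linfun (mulmxr relabel_mx).

Lemma relabel_homE v : relabel_hom v = v *m relabel_mx.
Proof. by rewrite lfunE. Qed.

Lemma direction_relabel S : direction (relabel S) = (relabel_hom @: direction S)%VS.
Proof.
have inj : {in S &, injective (fun B : {set 'I_m} => g @: B)}.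
  by move=> B C _ _; apply: imset_inj.
rewrite /direction big_imset //= limg_sum; apply: eq_bigr => B _.
rewrite big_imset //= limg_sum; apply: eq_bigr => C _.
by rewrite limg_line relabel_homE mulmxBl -!indicator_relabel.
Qed.

Lemma dim_relabel S : \dim (direction (relabel S)) = \dim (direction S).
Proof.
rewrite direction_relabel limg_dim_eq //.
suff -> : lker relabel_hom = 0%VS by rewrite capv0.
apply/eqP/lker0P => v w; rewrite !relabel_homE => /(congr1 (mulmxr relabel_mx^T)).
by rewrite /= -!mulmxA relabel_mxK !mulmx1.
Qed.
End Relabel.

(** If relabelling along [u] is always at least as good as along [v], with equality
    only when the two agree, then only [u] contributes maximizers. *)
Lemma maximizersU_dominated m n (u v : 'I_m -> 'I_n) (c : 'I_n -> R) F :
    injective u -> injective v ->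
    (forall B : {set 'I_m}, weight (c \o v) B <= weight (c \o u) B) ->
    (forall B : {set 'I_m}, weight (c \o v) B = weight (c \o u) B -> v @: B = u @: B) ->
  maximizers c (relabel u F :|: relabel v F) = relabel u (maximizers (c \o u) F).
Proof.
move=> u_inj v_inj le_vu eq_vu; apply/setP => X.
apply/maximizersP/imsetP => [[XF Xmax]|[B /maximizersP[FB Bmax] ->]].
  have [B FB eqX] : exists2 B, B \in F & X = u @: B.
    case/setUP: XF => /imsetP[B FB eqX]; exists B => //.
    rewrite eqX; apply: eq_vu; apply/le_anti; rewrite le_vu /=.
    rewrite -(weight_relabel u_inj) -(weight_relabel v_inj) -eqX; apply: Xmax.
    by apply/setUP; left; apply: imset_f.
  exists B => //; apply/maximizersP; split=> // C FC.
  rewrite -2!(weight_relabel u_inj) -eqX; apply: Xmax.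
  by apply/setUP; left; apply: imset_f.
split=> [|Y]; first by apply/setUP; left; apply: imset_f.
case/setUP => /imsetP[C FC ->]; rewrite !weight_relabel //; first exact: Bmax.
exact: le_trans (le_vu C) (Bmax C FC).
Qed.

Lemma maximizersU_tied m n (u v : 'I_m -> 'I_n) (c : 'I_n -> R) F :
    injective u -> injective v -> c \o v =1 c \o u ->
  maximizers c (relabel u F :|: relabel v F) =
    relabel u (maximizers (c \o u) F) :|: relabel v (maximizers (c \o u) F).
Proof.
move=> u_inj v_inj /funext cvu; apply/setP => X.
have wu (B : {set 'I_m}) : weight c (u @: B) = weight (c \o u) B.
  by rewrite weight_relabel.
have wv (B : {set 'I_m}) : weight c (v @: B) = weight (c \o u) B.
  by rewrite weight_relabel ?cvu.
apply/maximizersP/setUP => [[/setUP XF Xmax]|XF].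
  case: XF => /imsetP[B FB eqX]; [left|right]; apply/imsetP; exists B => //;
    apply/maximizersP; split=> // C FC;
    have <- : weight c X = weight (c \o u) B by rewrite eqX ?wu ?wv.
    by rewrite -wu; apply: Xmax; apply/setUP; left; apply: imset_f.
  by rewrite -wu; apply: Xmax; apply/setUP; left; apply: imset_f.
have [B [/maximizersP[FB Bmax] XB wX]] : exists B,
    [/\ B \in maximizers (c \o u) F, X = u @: B \/ X = v @: B
      & weight c X = weight (c \o u) B].
  by case: XF => /imsetP[B FB ->]; exists B; split; auto.
split=> [|Y].
  by apply/setUP; case: XB => ->; [left|right]; apply: imset_f.
by rewrite wX => /setUP[] /imsetP[C FC ->]; rewrite ?wu ?wv; apply: Bmax.
Qed.

(** * Parallel extension *)

Section Parallel.
Variable n : nat.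
Implicit Types (F S : {set {set 'I_n.+1}}) (B C : {set 'I_n.+1}).

(** A basis of a parallel extension is the image of an original basis under one of
    two injections of the ground set, which differ only at the maximum. *)
Definition keep_max : 'I_n.+1 -> 'I_n.+2 := lift ord_max.

Definition move_max (i : 'I_n.+1) : 'I_n.+2 :=
  if i == ord_max then ord_max else lift ord_max i.

Lemma keep_max_inj : injective keep_max.
Proof. exact: lift_inj. Qed.

Lemma move_max_inj : injective move_max.
Proof.
move=> i j; rewrite /move_max.
case: eqVneq => [->|_]; case: eqVneq => [->|_] //; last exact: lift_inj.
- by move/eqP; rewrite max_eq_lift.
- by move/eqP; rewrite lift_eq_max.
Qed.

Let keepI := keep_max_inj.
Let moveI := move_max_inj.

Lemma mem_keep_max B i : (lift ord_max i \in keep_max @: B) = (i \in B).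
Proof. exact: mem_up. Qed.

Lemma max_keep_max B : (ord_max \in keep_max @: B) = false.
Proof. exact: max_up. Qed.

Lemma max_move_max B : (ord_max \in move_max @: B) = (ord_max \in B).
Proof. by rewrite -(mem_imset _ _ moveI) /move_max eqxx. Qed.

Lemma old_max_move_max B : (lift ord_max ord_max \in move_max @: B) = false.
Proof.
apply/imsetP => -[i _]; rewrite /move_max; case: eqVneq => [_|im] /eqP.
  by rewrite lift_eq_max.
by rewrite lift_eq eq_sym (negbTE im).
Qed.

Lemma mem_move_max B i :
  i != ord_max -> (lift ord_max i \in move_max @: B) = (i \in B).
Proof. by move=> im; rewrite -(mem_imset _ _ moveI) /move_max (negbTE im). Qed.

Lemma move_maxE B :
  move_max @: B = if ord_max \in B then ord_max |: up (B :\ ord_max) else up B.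
Proof.
apply: eq_set_up => [|i].
  by rewrite max_move_max; case: ifP; rewrite ?max_up ?in_setU1 ?eqxx.
have [->|im] := eqVneq i ord_max.
  rewrite old_max_move_max; case: ifP => mB; last by rewrite mem_up mB.
  by rewrite in_setU1 lift_eq_max mem_up in_setD1 eqxx.
rewrite mem_move_max //; case: ifP => _; last by rewrite mem_up.
by rewrite in_setU1 lift_eq_max mem_up in_setD1 im.
Qed.

Lemma move_max_keep B : ord_max \notin B -> move_max @: B = keep_max @: B.
Proof. by move=> mB; rewrite move_maxE (negbTE mB). Qed.

Lemma parallel_bases_relabel F :
  parallel_bases F = relabel keep_max F :|: relabel move_max F.
Proof.
apply/setP => X; apply/setUP/setUP => -[] /imsetP[B].
- by move=> FB ->; left; apply: imset_f.
- rewrite inE => /andP[FB mB] ->; right; apply/imsetP; exists B => //.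
  by rewrite move_maxE mB.
- by move=> FB ->; left; apply/imsetP; exists B.
move=> FB ->; have [mB|mB] := boolP (ord_max \in B); last first.
  by left; apply/imsetP; exists B; rewrite ?move_max_keep.
by right; apply/imsetP; exists B; rewrite ?inE ?FB // move_maxE mB.
Qed.

Lemma weight_move_max (c : 'I_n.+2 -> R) B :
  weight (c \o move_max) B = weight (c \o keep_max) B +
    (if ord_max \in B then c ord_max - c (lift ord_max ord_max) else 0).
Proof.
have eq_off C : ord_max \notin C -> weight (c \o move_max) C = weight (c \o keep_max) C.
  move=> mC; apply: eq_bigr => i iC; rewrite /= /move_max; case: eqVneq => // im.
  by rewrite -im iC in mC.
case: ifP => [mB|/negbT mB]; last by rewrite addr0 eq_off.
rewrite /weight !(big_setD1 _ mB) /=.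
rewrite -![\sum_(i in _) _]/(weight (c \o _) (B :\ ord_max)) eq_off ?setD11 //.
by rewrite /move_max /keep_max eqxx; ring.
Qed.

(** Prescribing the two weights [a] and [b] independently realizes every outcome of
    the comparison between the old and the new maximum. *)
Definition parallel_lift_weight (c : 'I_n.+1 -> R) (a b : R) (j : 'I_n.+2) : R :=
  if unlift ord_max j is Some i then (if i == ord_max then a else c i) else b.

(** The three cases are those of the comparison between the weights of the new and
    the old maximum.  Conversely, lowering one of the two weights by 1, or
    neither, realizes each case. *)
Lemma face_family_parallel F T : face_family (parallel_bases F) T <->
  exists2 S, face_family F S &
    [\/ T = relabel keep_max S, T = relabel move_max S
      | T = relabel keep_max S :|: relabel move_max S].
Proof.
split=> [/asboolP[c ->]|[S /asboolP[c ->]] TE].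
  rewrite parallel_bases_relabel.
  have [lt|gt|eq] := ltgtP (c ord_max) (c (lift ord_max ord_max)).
  - exists (maximizers (c \o keep_max) F); first by apply/asboolP; exists (c \o keep_max).
    apply: Or31; apply: maximizersU_dominated => // B.
      by rewrite weight_move_max; case: ifP => _; lra.
    rewrite weight_move_max; case: ifP => [_ ?|/negbT mB _]; first by exfalso; lra.
    exact: move_max_keep.
  - exists (maximizers (c \o move_max) F); first by apply/asboolP; exists (c \o move_max).
    apply: Or32; rewrite setUC; apply: maximizersU_dominated => // B.
      by rewrite weight_move_max; case: ifP => _; lra.
    rewrite weight_move_max; case: ifP => [_ ?|/negbT mB _]; first by exfalso; lra.
    by rewrite move_max_keep.
  exists (maximizers (c \o keep_max) F); first by apply/asboolP; exists (c \o keep_max).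
  apply: Or33; apply: maximizersU_tied => // i.
  by rewrite /= /move_max /keep_max; case: eqVneq => // ->.
pose d a b := parallel_lift_weight c a b; pose w := c ord_max.
have keepE a : d w a \o keep_max =1 c.
  by move=> i; rewrite /d /= /parallel_lift_weight liftK; case: eqVneq => // ->.
have moveE a : d a w \o move_max =1 c.
  move=> i; rewrite /d /= /parallel_lift_weight /move_max.
  by case: eqVneq => [->|im]; rewrite ?unlift_none // liftK (negbTE im).
have dmax a b : d a b ord_max = b by rewrite /d /parallel_lift_weight unlift_none.
have dlift a b : d a b (lift ord_max ord_max) = a.
  by rewrite /d /parallel_lift_weight liftK eqxx.
apply/asboolP; case: TE => ->; rewrite parallel_bases_relabel.
- exists (d w (w - 1)); rewrite maximizersU_dominated //.
  + by rewrite (eq_maximizers _ (keepE _)).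
  + by move=> B; rewrite weight_move_max dmax dlift; case: ifP => _; lra.
  move=> B; rewrite weight_move_max dmax dlift.
  case: ifP => [_ ?|/negbT mB _]; first by exfalso; lra.
  exact: move_max_keep.
- exists (d (w - 1) w); rewrite setUC maximizersU_dominated //.
  + by rewrite (eq_maximizers _ (moveE _)).
  + by move=> B; rewrite weight_move_max dmax dlift; case: ifP => _; lra.
  move=> B; rewrite weight_move_max dmax dlift.
  case: ifP => [_ ?|/negbT mB _]; first by exfalso; lra.
  by rewrite move_max_keep.
exists (d w w); rewrite maximizersU_tied // ?(eq_maximizers _ (keepE _)) //.
by move=> i; rewrite moveE keepE.
Qed.

Definition avoids_max m (S : {set {set 'I_m.+1}}) :=
  [forall B in S, ord_max \notin B].

Definition contains_max m (S : {set {set 'I_m.+1}}) :=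
  [forall B in S, ord_max \in B].

Lemma avoids_maxPn m (S : {set {set 'I_m.+1}}) :
  reflect (exists2 B, B \in S & ord_max \in B) (~~ avoids_max S).
Proof.
rewrite /avoids_max negb_forall_in; apply: (iffP exists_inP) => -[B SB];
  by [rewrite negbK; exists B | exists B; rewrite ?negbK].
Qed.

Lemma relabel_move_avoids S : avoids_max S -> relabel move_max S = relabel keep_max S.
Proof. by move=> /forall_inP h; apply: eq_in_imset => B /h /move_max_keep. Qed.

Lemma indicator_move_max B : indicator_vec R (move_max @: B) =
  indicator_vec R (keep_max @: B) +
  (ord_max \in B)%:R *: (delta_mx 0 ord_max - delta_mx 0 (lift ord_max ord_max)).
Proof.
have sumE (g : 'I_n.+1 -> 'I_n.+2) : injective g ->
    indicator_vec R (g @: B) = \sum_(i in B) delta_mx 0 (g i).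
  by move=> g_inj; rewrite /indicator_vec big_imset //= => i j _ _; apply: g_inj.
rewrite !sumE //.
have eq_off C : ord_max \notin C ->
    \sum_(i in C) delta_mx 0 (move_max i) =
    \sum_(i in C) delta_mx 0 (keep_max i) :> 'rV[R]_n.+2.
  move=> mC; apply: eq_bigr => i iC; rewrite /move_max; case: eqVneq => // im.
  by rewrite -im iC in mC.
have [mB|mB] := boolP (ord_max \in B); last by rewrite scale0r addr0 eq_off.
rewrite !(big_setD1 _ mB) /= eq_off ?setD11 // {1}/move_max eqxx scale1r.
by rewrite /keep_max addrAC addrCA subrr addr0.
Qed.

(** The directions of the doubled face are the relabelled ones, which vanish at the
    new maximum, and the difference of the two maxima, which does not. *)
Lemma dim_direction_both S : ~~ avoids_max S ->
  \dim (direction (relabel keep_max S :|: relabel move_max S)) = (\dim (direction S)).+1.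
Proof.
move=> /avoids_maxPn[B0 SB0 mB0].
pose w : 'rV[R]_n.+2 := delta_mx 0 ord_max - delta_mx 0 (lift ord_max ord_max).
have w1 : w 0 ord_max = 1 by rewrite !mxE !eqxx max_eq_lift subr0.
set U := direction (relabel keep_max S).
have -> : direction (relabel keep_max S :|: relabel move_max S) = (U + <[w]>)%VS.
  apply/eqP; rewrite eqEsubv; apply/andP; split.
    have dec X : X \in relabel keep_max S :|: relabel move_max S ->
        exists2 B, B \in S & exists a : R,
          indicator_vec R X = indicator_vec R (keep_max @: B) + a *: w.
      case/setUP => /imsetP[B SB ->]; exists B => //.
        by exists 0; rewrite scale0r addr0.
      by exists (ord_max \in B)%:R; rewrite indicator_move_max.
    apply: direction_subP => X Y /dec[B SB [a ->]] /dec[C SC [b ->]].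
    rewrite opprD addrACA -scalerBl; apply: memv_add; last exact/memvZ/memv_line.
    by apply: mem_direction; apply: imset_f.
  rewrite subv_add; apply/andP; split.
    apply: direction_subP => X Y XS YS.
    by apply: mem_direction; apply/setUP; left.
  rewrite -memvE; have -> : w =
      indicator_vec R (move_max @: B0) - indicator_vec R (keep_max @: B0).
    by rewrite indicator_move_max mB0 scale1r addrAC subrr add0r.
  by apply: mem_direction; apply/setUP; [right|left]; apply: imset_f.
rewrite dimv_disjoint_sum; last first.
  apply/eqP; rewrite -subv0; apply/subvP => v; rewrite memv_cap => /andP[vU /vlineP[a va]].
  suff a0 : a = 0 by rewrite va a0 scale0r mem0v.
  move: vU; rewrite /U direction_relabel // => /memv_imgP[y _ vy].
  have := congr1 (fun z : 'rV[R]_n.+2 => z 0 ord_max) vy.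
  rewrite va relabel_homE [RHS]mxE big1 => [|i _].
    by rewrite [LHS]mxE w1 mulr1.
  by rewrite !mxE max_eq_lift mulr0.
have wN0 : w != 0 by apply: contraTneq (oner_neq0 R) => w0; rewrite -w1 w0 mxE eqxx.
by rewrite dim_vline wN0 addn1 /U dim_relabel.
Qed.

Definition relabel_both S := relabel keep_max S :|: relabel move_max S.

(** The members of the doubled family without the new maximum are those of the
    original one. *)
Lemma relabel_both_inj : injective relabel_both.
Proof.
move=> S1 S2 eqS; apply: (relabel_inj keepI).
have recover S : relabel keep_max S = [set X in relabel_both S | ord_max \notin X].
  apply/setP => X; rewrite inE; apply/idP/andP => [XS|[/setUP[//|/imsetP[B SB ->]]]].
    by split; [apply/setUP; left | case/imsetP: XS => B _ ->; rewrite max_keep_max].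
  by rewrite max_move_max => mB; rewrite move_max_keep // mem_relabel.
by rewrite !recover eqS.
Qed.

Definition nonavoiding F i := [set S in faces F i | ~~ avoids_max S].

(** On avoiding families the three constructions coincide, so they are counted
    there only once; this is what makes the union below disjoint. *)
Lemma faces_parallel F i : faces (parallel_bases F) i =
  relabel keep_max @: faces F i :|: (relabel move_max @: nonavoiding F i :|:
    (if i is j.+1 then relabel_both @: nonavoiding F j else set0)).
Proof.
apply/setP => T; rewrite inE; apply/andP/idP.
  case=> /face_family_parallel[S FS TE] /eqP dimT.
  have [SA|SN] := boolP (avoids_max S).
    have {}TE : T = relabel keep_max S.
      by case: TE => ->; rewrite ?relabel_move_avoids ?setUid.
    apply/setUP; left; rewrite TE imset_f // inE FS /=.
    by rewrite -dimT TE dim_relabel.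
  case: TE => TE; apply/setUP; [left|right|right]; rewrite TE.
  - by rewrite imset_f // inE FS -dimT TE dim_relabel /=.
  - apply/setUP; left; rewrite imset_f // inE SN andbT inE FS.
    by rewrite -dimT TE dim_relabel /=.
  apply/setUP; right; rewrite -dimT TE dim_direction_both //.
  by apply/imsetP; exists S => //; rewrite inE SN andbT inE FS /=.
case/setUP => [/imsetP[S]|/setUP[/imsetP[S]|]].
- rewrite inE => /andP[FS dimS] ->; rewrite dim_relabel //; split=> //.
  by apply/face_family_parallel; exists S => //; apply: Or31.
- rewrite 2!inE => /andP[/andP[FS dimS] _] ->; rewrite dim_relabel //; split=> //.
  by apply/face_family_parallel; exists S => //; apply: Or32.
case: i => [|i]; first by rewrite inE.
case/imsetP => S; rewrite 2!inE => /andP[/andP[FS dimS] SN] ->.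
rewrite dim_direction_both // eqSS; split=> //.
by apply/face_family_parallel; exists S => //; apply: Or33.
Qed.

Lemma keep_avoids S : avoids_max (relabel keep_max S).
Proof. by apply/forall_inP => X /imsetP[B _ ->]; rewrite max_keep_max. Qed.

Lemma move_nonavoids S : ~~ avoids_max S -> ~~ avoids_max (relabel move_max S).
Proof.
case/avoids_maxPn => B SB mB; apply/avoids_maxPn; exists (move_max @: B).
  exact: imset_f.
by rewrite max_move_max.
Qed.

Lemma both_nonavoids S : ~~ avoids_max S -> ~~ avoids_max (relabel_both S).
Proof.
move/move_nonavoids/avoids_maxPn => [X XS mX]; apply/avoids_maxPn; exists X => //.
by apply/setUP; right.
Qed.

Lemma move_neq_both S1 S2 : ~~ avoids_max S2 -> relabel move_max S1 <> relabel_both S2.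
Proof.
case/avoids_maxPn => B SB mB eqS.
have : keep_max @: B \in relabel move_max S1.
  by rewrite eqS; apply/setUP; left; apply: imset_f.
case/imsetP => C _ /setP/(_ (lift ord_max ord_max)).
by rewrite mem_keep_max mB old_max_move_max.
Qed.

Lemma card_disjointU (T : finType) (A B : {set T}) :
  (forall z, z \in A -> z \notin B) -> #|A :|: B| = (#|A| + #|B|)%N.
Proof.
move=> h; rewrite cardsU -[RHS]subn0; congr subn; apply/eqP; rewrite cards_eq0.
apply/eqP/setP => z; rewrite !inE; apply/negbTE/nandP.
by case: (boolP (z \in A)) => [/h|]; auto.
Qed.

Lemma card_faces_parallel F i : #|faces (parallel_bases F) i| =
  (#|faces F i| + (#|nonavoiding F i| + if i is j.+1 then #|nonavoiding F j| else 0))%N.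
Proof.
have NP k S : S \in nonavoiding F k -> ~~ avoids_max S by rewrite inE => /andP[].
rewrite faces_parallel card_disjointU; last first.
  move=> T /imsetP[S _ ->]; have := keep_avoids S; apply: contraL => /setUP[/imsetP[S']|].
    by move=> /NP S'N ->; apply: move_nonavoids.
  by case: i => [|i]; rewrite ?inE // => /imsetP[S' /NP S'N ->]; apply: both_nonavoids.
rewrite card_disjointU; last first.
  move=> T /imsetP[S _ ->]; case: i => [|i]; rewrite ?inE //.
  by apply/imsetP => -[S' /NP /move_neq_both]; apply.
rewrite !card_imset; [|exact: relabel_inj|exact: relabel_inj].
by case: i => [|i]; rewrite ?cards0 ?(card_imset _ relabel_both_inj).
Qed.

Lemma card_avoiding_parallel F i :
  #|[set S in faces (parallel_bases F) i | avoids_max S]| = #|faces F i|.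
Proof.
rewrite -(card_imset _ (relabel_inj keepI)); congr #|pred_of_set _|.
apply/setP => T; rewrite inE faces_parallel; apply/andP/idP; last first.
  by move=> TF; split; [apply/setUP; left | case/imsetP: TF => S _ ->; apply: keep_avoids].
have NP k S : S \in nonavoiding F k -> ~~ avoids_max S by rewrite inE => /andP[].
case=> /setUP[//|/setUP[/imsetP[S /NP SN ->]|]].
  by rewrite (negbTE (move_nonavoids SN)).
case: i => [|i]; first by rewrite inE.
by move=> /imsetP[S /NP SN ->]; rewrite (negbTE (both_nonavoids SN)).
Qed.

Lemma faces_neq0 F i S : F != set0 -> S \in faces F i -> S != set0.
Proof. by move=> F0; rewrite inE => /andP[/asboolP[c ->] _]; apply: maximizers_neq0. Qed.

Lemma card_containing_parallel F i : F != set0 ->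
  #|[set S in faces (parallel_bases F) i | contains_max S]| =
  #|[set S in faces F i | contains_max S]|.
Proof.
move=> F0; rewrite -[RHS](card_imset _ (relabel_inj moveI)); congr #|pred_of_set _|.
have keepN S : S != set0 -> ~~ contains_max (relabel keep_max S).
  case/set0Pn => B SB; apply/forall_inPn; exists (keep_max @: B); first exact: imset_f.
  by rewrite max_keep_max.
apply/setP => T; rewrite inE faces_parallel; apply/andP/imsetP.
  case=> /setUP[/imsetP[S SF ->]|/setUP[/imsetP[S]|]].
  - by rewrite (negbTE (keepN _ (faces_neq0 F0 SF))).
  - rewrite inE => /andP[SF _] -> /forall_inP SC; exists S => //.
    rewrite inE SF /=; apply/forall_inP => B SB.
    by rewrite -max_move_max; apply/SC/imset_f.
  case: i => [|i]; first by rewrite inE.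
  case/imsetP => S; rewrite inE => /andP[SF _] -> /forall_inP SC.
  suff : contains_max (relabel keep_max S) by rewrite (negbTE (keepN _ (faces_neq0 F0 SF))).
  by apply/forall_inP => X XS; apply: SC; apply/setUP; left.
case=> S; rewrite inE => /andP[SF /forall_inP SC] ->; split; last first.
  by apply/forall_inP => X /imsetP[B SB ->]; rewrite max_move_max SC.
apply/setUP; right; apply/setUP; left; rewrite imset_f // inE SF /=.
have /set0Pn[B SB] := faces_neq0 F0 SF.
by apply/avoids_maxPn; exists B; rewrite ?SC.
Qed.

End Parallel.

(** * Duality and series extension *)

Section Dual.
Variable n : nat.
Implicit Types (F S : {set {set 'I_n}}) (B C : {set 'I_n}).

Definition dual_family F := [set ~: B | B in F].

Lemma mem_dual F B : (~: B \in dual_family F) = (B \in F).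
Proof. by rewrite mem_imset //; apply: setC_inj. Qed.

Lemma dual_familyK : involutive dual_family.
Proof.
by move=> F; apply/setP => B; rewrite -[B]setCK !mem_dual setCK.
Qed.

Lemma weight_dual (c : 'I_n -> R) B :
  weight c (~: B) = \sum_i c i - weight c B.
Proof.
rewrite /weight [\sum_i c i](bigID (mem B)) /= addrC addrK.
by apply: eq_bigl => i; rewrite inE.
Qed.

(** The weights of a set and of its complement have a constant sum. *)
Lemma maximizers_dual (c : 'I_n -> R) F :
  maximizers c (dual_family F) = dual_family (maximizers (fun i => - c i) F).
Proof.
have wN B : weight (fun i => - c i) B = - weight c B by rewrite /weight sumrN.
apply/setP => X; rewrite -[X]setCK mem_dual; set B := ~: X.
apply/maximizersP/maximizersP; rewrite mem_dual => -[FB Bmax]; split=> // C FC.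
  by have := Bmax (~: C); rewrite mem_dual !wN !weight_dual => /(_ FC); lra.
rewrite -[C]setCK in FC *; rewrite mem_dual in FC.
by have := Bmax _ FC; rewrite !wN !weight_dual; lra.
Qed.

Lemma face_family_dual F S :
  face_family (dual_family F) (dual_family S) = face_family F S.
Proof.
apply/asboolP/asboolP => -[c SE]; exists (fun i => - c i).
  apply: (can_inj dual_familyK); rewrite SE maximizers_dual.
  by [].
rewrite SE maximizers_dual; congr dual_family; apply: eq_maximizers => i.
by rewrite opprK.
Qed.

Lemma indicator_dual B :
  indicator_vec R (~: B) = \sum_i delta_mx 0 i - indicator_vec R B.
Proof.
rewrite /indicator_vec [\sum_i _](bigID (mem B)) /= addrC addrK.
by apply: eq_bigl => i; rewrite inE.
Qed.

Lemma direction_dual S : direction (dual_family S) = direction S.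
Proof.
have sub T : (direction (dual_family T) <= direction T)%VS.
  apply: direction_subP => X Y /imsetP[B TB ->] /imsetP[C TC ->].
  by rewrite !indicator_dual opprB addrC addrA subrK mem_direction.
by apply/eqP; rewrite eqEsubv sub /= -{1}[S]dual_familyK sub.
Qed.

Lemma faces_dual F i : faces (dual_family F) i = dual_family @: faces F i.
Proof.
apply/setP => S; rewrite -[S]dual_familyK; set T := dual_family S.
rewrite (mem_imset _ _ (can_inj dual_familyK)) !inE.
by rewrite face_family_dual direction_dual.
Qed.

Lemma card_faces_dual F i : #|faces (dual_family F) i| = #|faces F i|.
Proof. by rewrite faces_dual card_imset //; apply: can_inj dual_familyK. Qed.

End Dual.

Lemma contains_max_dual n (S : {set {set 'I_n.+1}}) :
  contains_max (dual_family S) = avoids_max S.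
Proof.
apply/forall_inP/forall_inP => h B SB.
  by have := h (~: B); rewrite mem_dual inE; apply.
by case/imsetP: SB => C SC ->; rewrite inE h.
Qed.

Lemma card_containing_dual n (F : {set {set 'I_n.+1}}) i :
  #|[set S in faces (dual_family F) i | contains_max S]| =
  #|[set S in faces F i | avoids_max S]|.
Proof.
rewrite -[RHS](card_imset _ (can_inj (@dual_familyK _))); congr #|pred_of_set _|.
apply/setP => S; rewrite -[S]dual_familyK; set T := dual_family S.
rewrite (mem_imset _ _ (can_inj (@dual_familyK _))) !inE.
by rewrite face_family_dual direction_dual contains_max_dual.
Qed.

Lemma card_avoiding_dual n (F : {set {set 'I_n.+1}}) i :
  #|[set S in faces (dual_family F) i | avoids_max S]| =
  #|[set S in faces F i | contains_max S]|.
Proof. by rewrite -card_containing_dual dual_familyK. Qed.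

Lemma series_bases_dual n (F : {set {set 'I_n.+1}}) :
  series_bases F = dual_family (parallel_bases (dual_family F)).
Proof.
apply/setP => X; rewrite -[X]setCK mem_dual; set Y := ~: X.
rewrite seriesE parallelE !inE negb_and; congr andb.
rewrite -[RHS]mem_dual dual_familyK; congr (_ \in F).
apply/setP => i; rewrite !inE negb_or; congr andb.
by rewrite negb_and.
Qed.

(** * Face polynomials *)

Definition filtered_face_poly n (P : pred {set {set 'I_n.+1}}) F : {poly int} :=
  \poly_(i < n.+2) #|[set S in faces F i | P S]|%:R.

Local Notation avoiding_poly := (filtered_face_poly (@avoids_max _)).
Local Notation containing_poly := (filtered_face_poly (@contains_max _)).

Section FacePolynomials.
Variable n : nat.
Implicit Types (F S : {set {set 'I_n.+1}}).

Definition face_poly F : {poly int} := \poly_(i < n.+2) #|faces F i|%:R.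

Lemma faces_gt F i : (n.+1 < i)%N -> faces F i = set0.
Proof.
move=> ni; apply/setP => S; rewrite !inE; apply/negbTE/nandP; right.
by rewrite neq_ltn (leq_ltn_trans (dim_direction_le S) ni).
Qed.

Lemma coef_face_poly F i : (face_poly F)`_i = #|faces F i|%:R.
Proof. by rewrite coef_poly; case: ltnP => // ni; rewrite faces_gt ?cards0. Qed.

Lemma coef_filtered_face_poly P F i :
  (filtered_face_poly P F)`_i = #|[set S in faces F i | P S]|%:R.
Proof.
rewrite coef_poly; case: ltnP => // ni; rewrite faces_gt //.
rewrite (_ : [set _ in _ | _] = set0) ?cards0 //.
by apply/setP => S; rewrite !inE.
Qed.

Lemma coef_nonavoiding F i :
  (face_poly F - avoiding_poly F)`_i = #|nonavoiding F i|%:R.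
Proof.
rewrite coefB coef_face_poly coef_filtered_face_poly.
rewrite -(cardsID [set S | avoids_max S] (faces F i)) natrD.
have -> : faces F i :&: [set S | avoids_max S] = [set S in faces F i | avoids_max S].
  by apply/setP => S; rewrite !inE.
have -> : faces F i :\: [set S | avoids_max S] = nonavoiding F i.
  by apply/setP => S; rewrite !inE andbC.
by rewrite addrAC subrr add0r.
Qed.

Definition interlaced_family F : Prop :=
  interlaced (face_poly F - avoiding_poly F) (face_poly F - containing_poly F)
    (face_poly F).

End FacePolynomials.

Lemma interlaced_parallel n (F : {set {set 'I_n.+1}}) : F != set0 ->
  interlaced_family F -> interlaced_family (parallel_bases F).
Proof.
move=> F0 /interlaced_step; rewrite /interlaced_family.
have -> : avoiding_poly (parallel_bases F) = face_poly F.
  by apply/polyP => i; rewrite coef_filtered_face_poly coef_face_poly card_avoiding_parallel.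
have -> : containing_poly (parallel_bases F) = containing_poly F.
  by apply/polyP => i; rewrite !coef_filtered_face_poly card_containing_parallel.
have -> : face_poly (parallel_bases F) =
    face_poly F + (1 + 'X) * (face_poly F - avoiding_poly F).
  apply/polyP => i; rewrite mulrDl mul1r coef_face_poly coefD coefD coefXM.
  rewrite coef_nonavoiding coef_face_poly card_faces_parallel !natrD.
  by case: i => [|i]; rewrite ?coef_nonavoiding.
by move=> h; rewrite [_ + _ - face_poly F]addrAC subrr add0r
  [_ + _ - containing_poly F]addrAC.
Qed.

Lemma interlaced_dual n (F : {set {set 'I_n.+1}}) :
  interlaced_family F -> interlaced_family (dual_family F).
Proof.
move=> /interlaced_sym; rewrite /interlaced_family.
have -> : avoiding_poly (dual_family F) = containing_poly F.
  by apply/polyP => i; rewrite !coef_filtered_face_poly card_avoiding_dual.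
have -> : containing_poly (dual_family F) = avoiding_poly F.
  by apply/polyP => i; rewrite !coef_filtered_face_poly card_containing_dual.
have -> // : face_poly (dual_family F) = face_poly F.
by apply/polyP => i; rewrite !coef_face_poly card_faces_dual.
Qed.

(** Starting from one element that is in the unique basis makes [U_{1,2}] a
    parallel extension, so no polytope has to be computed but a point. *)
Definition U11_bases : {set {set 'I_1}} := [set [set ord0]].

Lemma faces_U11 (i : nat) : faces U11_bases i = if i is 0 then [set U11_bases] else set0.
Proof.
have maxE c : maximizers c U11_bases = U11_bases.
  apply/setP => B; apply/maximizersP/idP => [[]//|UB]; split=> // C.
  by move: UB; rewrite !inE => /eqP-> /eqP->; exact: lexx.
have dir0 : \dim (direction U11_bases) = 0%N.
  apply/eqP; rewrite dimv_eq0 -subv0; apply: direction_subP => B C.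
  by rewrite !inE => /eqP-> /eqP->; rewrite subrr mem0v.
apply/setP => S; rewrite inE; apply/andP/idP.
  by case=> /asboolP[c ->]; rewrite maxE dir0; case: i => // _; rewrite inE.
case: i => [|i]; rewrite inE // => /eqP->; rewrite dir0; split=> //.
by apply/asboolP; exists (fun=> 0); rewrite maxE.
Qed.

Lemma interlaced_U11 : interlaced_family U11_bases.
Proof.
have card_pred (P : pred {set {set 'I_1}}) i :
    #|[set S in faces U11_bases i | P S]| = ((i == 0) && P U11_bases)%N.
  rewrite faces_U11; case: i => [|i] /=.
    rewrite (_ : [set _ in _ | _] = if P U11_bases then [set U11_bases] else set0).
      by case: (P _); rewrite ?cards1 ?cards0.
    apply/setP => S; case: ifP => PU; rewrite !inE.
      by case: eqP => // ->.
    by apply/negbTE/nandP; case: eqP => [->|_]; [right; rewrite PU | left].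
  by apply/eqP; rewrite cards_eq0; apply/eqP/setP => S; rewrite !inE.
have ord01 : ord_max = ord0 :> 'I_1 by apply/val_inj.
have UB : [set ord0] \in U11_bases by rewrite inE.
rewrite /interlaced_family.
have -> : avoiding_poly U11_bases = 0.
  apply/polyP => i; rewrite coef_filtered_face_poly coef0 card_pred.
  suff -> : avoids_max U11_bases = false by rewrite andbF.
  by apply/negbTE/avoids_maxPn; exists [set ord0]; rewrite // inE ord01.
have -> : containing_poly U11_bases = 1.
  apply/polyP => i; rewrite coef_filtered_face_poly coef1 card_pred.
  suff -> : contains_max U11_bases by rewrite andbT.
  by apply/forall_inP => B; rewrite inE => /eqP->; rewrite inE ord01.
have -> : face_poly U11_bases = 1.
  apply/polyP => i; rewrite coef_face_poly coef1 faces_U11.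
  by case: i => [|i]; rewrite ?cards1 ?cards0.
by rewrite subr0 subrr; exact: interlaced_base.
Qed.

Lemma U12_bases_parallel : U12_bases = parallel_bases U11_bases.
Proof.
apply/setP => X; rewrite parallelE !inE.
have ord01 : ord_max = ord0 :> 'I_1 by apply/val_inj.
have cardX : #|X| = ((lift ord_max (ord0 : 'I_1) \in X) + (ord_max \in X))%N.
  rewrite -sum1_card big_mkcond big_ord_recr big_ord1 /=.
  rewrite (_ : widen_ord _ _ = lift ord_max ord0); last exact/val_inj.
  by case: (_ \in _); case: (_ \in _).
rewrite cardX ord01; set l := lift _ _ \in X; set h := ord_max \in X.
have -> : ([set i : 'I_1 | (lift ord_max i \in X) || (i == ord0) && (ord_max \in X)]
    == [set ord0]) = l || h.
  apply/eqP/idP => [/setP/(_ ord0)|lh]; first by rewrite !inE eqxx.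
  by apply/setP => i; rewrite !inE (ord1 i) eqxx.
by case: l; case: h.
Qed.

Lemma interlaced_snake n (M : matroid 'I_n.+1) :
  snake M -> interlaced_family (bases M).
Proof.
(* Induction on [snake] needs a goal at an arbitrary index, not only at a
   successor. *)
pose goal m := if m is k.+1 return matroid 'I_m -> Prop
  then fun N => interlaced_family (bases N) else fun=> True.
suff gen m (N : matroid 'I_m) : snake N -> goal m N by exact: gen.
elim=> {m N} [|m N _ IH|m N _ IH]; rewrite /goal /=.
- rewrite /= U12_bases_parallel; apply: interlaced_parallel interlaced_U11.
  by apply/set0Pn; exists [set ord0]; rewrite inE.
- exact: interlaced_parallel (bases_neq0 N) IH.
rewrite /= series_bases_dual; apply/interlaced_dual/interlaced_parallel.
  have /set0Pn[B NB] := bases_neq0 N.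
  by apply/set0Pn; exists (~: B); rewrite mem_dual.
exact: interlaced_dual.
Qed.

Lemma card_faces_log_concave n (M : matroid 'I_n) i : snake M -> (0 < i)%N ->
  (#|faces (bases M) i.-1| * #|faces (bases M) i.+1| <= #|faces (bases M) i| ^ 2)%N.
Proof.
case: n M => [|n] M sM; first by inversion sM.
case: i => // i _; have [_ _ /(_ i.+1 i.+2 (ltnSn _))] := interlaced_snake sM.
rewrite !coefXM /= !coef_face_poly -!natrM ler_nat => h.
by rewrite mulnC expnS expn1.
Qed.

End Families.

(** * Faces of base polytopes *)

From mathcomp Require Import finmap all_classical all_reals convex.
Local Open Scope classical_set_scope.

Section Geometry.
Variables (R : realType) (n : nat).
Local Notation V := 'rV[R]_n.
Implicit Types (A : set V) (S : {set {set 'I_n}}) (B C : {set 'I_n}) (c x y : V).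

Lemma dotD c x y : dot c (x + y) = dot c x + dot c y.
Proof. by rewrite /dot -big_split; apply: eq_bigr => i _; rewrite !mxE mulrDr. Qed.

Lemma dotZ c a x : dot c (a *: x) = a * dot c x.
Proof. by rewrite /dot big_distrr; apply: eq_bigr => i _; rewrite !mxE /= mulrCA. Qed.

Lemma dot_indicator c B : dot c (indicator_vec R B) = weight (c 0) B.
Proof.
rewrite /dot /weight [RHS]big_mkcond; apply: eq_bigr => i _.
rewrite /indicator_vec summxE; case: ifP => iB.
  rewrite (bigD1 i) //= big1 => [|j /andP[_ ji]]; first by rewrite mxE !eqxx addr0 mulr1.
  by rewrite mxE eq_sym (negbTE ji) andbF.
rewrite big1 ?mulr0 // => j jB; rewrite mxE; case: eqVneq => [_|//].
by case: eqVneq => // ij; rewrite ij jB in iB.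
Qed.

Lemma dot_row_indicator (w : 'I_n -> R) B :
  dot (\row_i w i) (indicator_vec R B) = weight w B.
Proof. by rewrite dot_indicator; apply: eq_bigr => i _; rewrite mxE. Qed.

Lemma affine_hull_affine A : affine_set (affine_hull A).
Proof. by move=> x y t Hx Hy H hH; apply: hH.1; [exact: Hx|exact: Hy]. Qed.

Lemma affine_hull_min A H : affine_set H -> A `<=` H -> affine_hull A `<=` H.
Proof. exact: smallest_sub. Qed.

Lemma sub_affine_hull A : A `<=` affine_hull A.
Proof. exact: sub_gen_smallest. Qed.

Lemma affine_set_dot c b : affine_set [set x | dot c x = b].
Proof. by move=> x y t /= xb yb; rewrite dotD !dotZ xb yb; ring. Qed.

Lemma affine_hull0 : affine_hull (set0 : set V) = set0.
Proof. by apply: smallest_id. Qed.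

Definition flat (x : V) (U : {vspace V}) : set V := [set x + u | u in [set u | u \in U]].

Lemma affine_set_flat x U : affine_set (flat x U).
Proof.
move=> y z t [u /= uU <-] [w /= wU <-]; exists (t *: u + (1 - t) *: w).
  by rewrite /= memvD ?memvZ.
by rewrite !scalerDr addrACA -scalerDl [t + _]addrC subrK scale1r.
Qed.

Lemma flat_direction_inj x y U W : flat x U = flat y W -> U = W.
Proof.
wlog suff sub : x y U W / flat x U = flat y W -> (U <= W)%VS.
  by move=> h; apply/eqP; rewrite eqEsubv (sub x y) ?(sub y x).
move=> eqF; apply/subvP => u uU.
have [v vW vE] : flat y W (x + u) by rewrite -eqF; exists u.
have [w wW wE] : flat y W x by rewrite -eqF; exists 0; rewrite ?addr0 //=; apply: mem0v.
have -> : u = v - w.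
  by apply: (addrI x); rewrite -vE -[in RHS]wE addrACA addrN addr0.
exact: memvB.
Qed.

Definition indicators S : set V := [set indicator_vec R B | B in [set` S]].

(** Any affine set containing the vertices contains, with a base point [x0], all
    [x0 + u] for [u] in a set closed under scaling and, through midpoints, under
    addition; hence it contains the whole flat. *)
Lemma affine_hull_between S B0 A : B0 \in S ->
  indicators S `<=` A -> A `<=` affine_hull (indicators S) ->
  affine_hull A = flat (indicator_vec R B0) (direction R S).
Proof.
move=> SB0 SA AS; pose x0 := indicator_vec R B0.
have hull_flat : affine_hull (indicators S) `<=` flat x0 (direction R S).
  apply: affine_hull_min; first exact: affine_set_flat.
  move=> _ [B /= SB <-]; exists (indicator_vec R B - x0) => /=; last by rewrite addrC subrK.
  exact: mem_direction.
apply/seteqP; split.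
  by apply: affine_hull_min; [exact: affine_set_flat|exact: subset_trans hull_flat].
pose D := [set u | affine_hull A (x0 + u)].
have vert B : B \in S -> affine_hull A (indicator_vec R B).
  by move=> SB; apply: sub_affine_hull; apply: SA; exists B.
have D0 : D 0 by rewrite /D /= addr0; apply: vert.
have DZ a u : D u -> D (a *: u).
  move=> Du; rewrite /D /=.
  have -> : x0 + a *: u = a *: (x0 + u) + (1 - a) *: x0.
    by rewrite scalerDr scalerBl scale1r [RHS]addrC addrA subrK.
  by apply: affine_hull_affine => //; apply: vert.
have DD u w : D u -> D w -> D (u + w).
  move=> Du Dw; have -> : u + w = 2 *: (2^-1 *: (u + w)).
    by rewrite scalerA mulfV ?scale1r // pnatr_eq0.
  apply: (DZ); rewrite /D /=.
  have -> : x0 + 2^-1 *: (u + w) = 2^-1 *: (x0 + u) + (1 - 2^-1) *: (x0 + w).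
    have -> : 1 - 2^-1 = 2^-1 :> R by field.
    rewrite -scalerDr addrACA [RHS]scalerDr; congr (_ + _).
    by rewrite -mulr2n -scaler_nat scalerA mulVf ?scale1r // pnatr_eq0.
  exact: affine_hull_affine.
have DB B C : B \in S -> C \in S -> D (indicator_vec R B - indicator_vec R C).
  move=> SB SC; have -> : indicator_vec R B - indicator_vec R C =
      (indicator_vec R B - x0) + (-1) *: (indicator_vec R C - x0).
    by rewrite scaleN1r opprB addrA subrK.
  by apply: DD; [|apply: DZ]; rewrite /D /= addrC subrK; apply: vert.
move=> _ [u /= uD <-]; rewrite -[affine_hull A _]/(D u).
case/memv_sumP: uD => uB uBd ->; apply: big_ind => // B SB.
case/memv_sumP: (uBd B SB) => uC uCd ->; apply: big_ind => // C SC.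
by have /vlineP[a ->] := uCd C SC; apply: (DZ); exact: DB.
Qed.

Lemma has_dim_between S A d : S != finset.set0 ->
  indicators S `<=` A -> A `<=` affine_hull (indicators S) ->
  has_dim A d <-> \dim (direction R S) = d.
Proof.
case/set0Pn => B0 SB0 SA AS; have hullE := affine_hull_between SB0 SA AS.
split=> [[x [U [hullU <-]]]|dimS].
  congr (\dim _); apply: (@flat_direction_inj (indicator_vec R B0) x).
  exact: etrans (esym hullE) hullU.
by exists (indicator_vec R B0), (direction R S).
Qed.

Section Polytope.
Variable M : matroid 'I_n.
Local Notation P := (base_polytope R M).
Local Notation F := (bases M).

Lemma indicator_polytope B : B \in F -> P (indicator_vec R B).
Proof. by move=> FB; apply: sub_gen_smallest; exists B. Qed.

Lemma polytope_dot_le c b : (forall B, B \in F -> dot c (indicator_vec R B) <= b) ->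
  forall x, P x -> dot c x <= b.
Proof.
move=> le_b; apply: smallest_sub => [|_ [B FB <-]]; last exact: le_b.
apply/convex_setW => x y /set_mem /= xb /set_mem /= yb t t0 t1.
apply/mem_set => /=; rewrite /conv /= dotD !dotZ /unstable.onem.
nra.
Qed.

(** The points strictly below the level [b], together with the affine span of the
    vertices at that level, form a convex set containing all vertices.  This
    replaces the usual argument on the coefficients of a convex combination. *)
Lemma polytope_exposed c b : (forall x, P x -> dot c x <= b) ->
  P `&` [set x | dot c x = b] `<=`
    affine_hull (indicators
      (finset (fun B => (B \in F) && (dot c (indicator_vec R B) == b)))).
Proof.
move=> le_b; set S := finset _.
pose K := [set x | dot c x < b \/ dot c x = b /\ affine_hull (indicators S) x].
suff PK : P `<=` K.
  by move=> x [/PK[lt|[_ //]] /= eqb]; rewrite eqb ltxx in lt.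
apply: smallest_sub => [|_ [B /= FB <-]]; last first.
  have := le_b _ (indicator_polytope FB); rewrite le_eqVlt => /orP[/eqP eqb|]; last by left.
  right; split=> //; apply: sub_affine_hull; exists B => //=.
  by rewrite inE FB eqb eqxx.
apply/convex_setW => x y /set_mem xK /set_mem yK t t0 t1.
apply/mem_set; rewrite /K /conv /= dotD !dotZ /unstable.onem.
case: xK => [xb|[xb xS]]; case: yK => [yb|[yb yS]]; try by left; nra.
by right; split; [rewrite xb yb; ring|apply: affine_hull_affine].
Qed.

(** Defined through the affine span, so that it depends on [S] only and not on a
    supporting functional. *)
Definition polytope_face S : set V := P `&` affine_hull (indicators S).

Lemma polytope_face_maximizers (c : 'I_n -> R) :
  exists2 b, (forall x, P x -> dot (\row_i c i) x <= b) &
    polytope_face (maximizers c F) = P `&` [set x | dot (\row_i c i) x = b].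
Proof.
have /set0Pn[B0 B0max] := maximizers_neq0 c (bases_neq0 M).
have le_b : forall x, P x -> dot (\row_i c i) x <= weight c B0.
  apply: polytope_dot_le => B FB; rewrite dot_row_indicator.
  by have /maximizersP[_] := B0max; apply.
exists (weight c B0) => //.
have SE : maximizers c F = finset (fun B => (B \in F) &&
    (dot (\row_i c i) (indicator_vec R B) == weight c B0)).
  apply/setP => B; rewrite [RHS]inE dot_row_indicator; apply/maximizersP/andP => -[FB].
    move=> Bmax; split=> //; have /maximizersP[FB0 B0m] := B0max.
    by rewrite eq_le B0m // Bmax.
  by move=> /eqP->; split=> //; have /maximizersP[] := B0max.
apply/seteqP; split=> x [Px]; last first.
  by move=> xb; split=> //; rewrite SE; apply: polytope_exposed.
move=> Hx; split=> //; move: x Hx {Px}.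
apply: affine_hull_min; first exact: affine_set_dot.
by move=> _ [B /= + <-]; rewrite SE inE => /andP[_ /eqP].
Qed.

Lemma mem_polytope_face S B : face_family R F S ->
  (B \in S) <-> B \in F /\ polytope_face S (indicator_vec R B).
Proof.
case/asboolP => c ->; split=> [Bmax|[FB]].
  have /maximizersP[FB _] := Bmax; split=> //; split; first exact: indicator_polytope.
  by apply: sub_affine_hull; exists B.
have [b le_b ->] := polytope_face_maximizers c.
move=> [_ /=]; rewrite dot_row_indicator => Bb; apply/maximizersP; split=> // C FC.
by rewrite Bb -dot_row_indicator; apply: le_b; exact: indicator_polytope.
Qed.

Lemma polytope_face_inj :
  {in [pred S | face_family R F S] &, injective polytope_face}.
Proof.
move=> S T FS FT eqST; apply/setP => B.
apply/idP/idP => [/(mem_polytope_face B FS)|/(mem_polytope_face B FT)] h.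
  by apply/(mem_polytope_face B FT); rewrite -eqST.
by apply/(mem_polytope_face B FS); rewrite eqST.
Qed.

Lemma has_dim_polytope_face S d : face_family R F S ->
  has_dim (polytope_face S) d <-> \dim (direction R S) = d.
Proof.
move=> FS; apply: has_dim_between => [||x []//].
  by case/asboolP: FS => c ->; apply/maximizers_neq0/bases_neq0.
by move=> _ [B /= SB <-]; have [_] := (mem_polytope_face B FS).1 SB.
Qed.

Lemma has_dim_set0 d : ~ has_dim (set0 : set V) d.
Proof.
case=> x [U [+ _]]; rewrite affine_hull0 => /seteqP[_ /(_ x)]; apply.
by exists 0; rewrite ?addr0 //=; apply: mem0v.
Qed.

Lemma is_faceP (G : set V) : G !=set0 ->
  is_face P G <-> exists2 S, face_family R F S & G = polytope_face S.
Proof.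
move=> [x Gx]; split=> [[c [b [le_b GE]]]|[S /asboolP[c ->] ->]]; last first.
  by have [b le_b GE] := polytope_face_maximizers c; exists (\row_i c i), b.
have [b' le_b' GE'] := polytope_face_maximizers (c 0).
have cE : \row_i c 0 i = c by apply/rowP => i; rewrite mxE.
rewrite cE in le_b' GE'.
exists (maximizers (c 0) F); first by apply/asboolP; exists (c 0).
suff eqb : b' = b by rewrite GE GE' eqb.
move: Gx; rewrite GE => -[Px xb].
have /set0Pn[B0 B0max] := maximizers_neq0 (c 0) (bases_neq0 M).
have [_ B0b'] : (P `&` [set x | dot c x = b']) (indicator_vec R B0).
  rewrite -GE'; have face_max : face_family R F (maximizers (c 0) F).
    by apply/asboolP; exists (c 0).
  exact: ((mem_polytope_face B0 face_max).1 B0max).2.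
apply/le_anti/andP; split; last by rewrite -xb; apply: le_b'.
rewrite -B0b'; apply: le_b; apply: indicator_polytope.
by have /maximizersP[] := B0max.
Qed.

Lemma fvec_base_polytope i : fvec P i = #|faces R F i|.
Proof.
rewrite /fvec (_ : [set G | _] =
    [set` [fset polytope_face S | S in enum (faces R F i)]%fset]).
  rewrite set_fsetK card_in_imfset /=; first by rewrite undup_id ?enum_uniq // -cardE.
  move=> S T; rewrite !mem_enum !inE => /andP[FS _] /andP[FT _].
  exact: polytope_face_inj.
apply/seteqP; split=> G /=.
  case=> faceG dimG; have G0 : G !=set0.
    by apply/set0P; apply/eqP => G0; rewrite G0 in dimG; apply: has_dim_set0 dimG.
  have [S FS GE] := (is_faceP G0).1 faceG.
  apply/imfsetP; exists S => //=; rewrite mem_enum inE FS /=.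
  by apply/eqP/has_dim_polytope_face => //; rewrite -GE.
case/imfsetP => S /=; rewrite mem_enum inE => /andP[FS /eqP dimS] ->.
have /set0Pn[B SB] : S != finset.set0.
  by case/asboolP: FS => c ->; apply/maximizers_neq0/bases_neq0.
split; last exact/has_dim_polytope_face.
apply/is_faceP; last by exists S.
by exists (indicator_vec R B); have [_] := (mem_polytope_face B FS).1 SB.
Qed.

End Polytope.
End Geometry.

Theorem corollary6 (R : realType) (n : nat) (M : matroid 'I_n) (d : nat) :
  snake M -> has_dim (base_polytope R M) d ->
  forall i : nat, (0 < i < d)%N ->
    (fvec (base_polytope R M) i.-1 * fvec (base_polytope R M) i.+1
      <= fvec (base_polytope R M) i ^ 2)%N.
Proof.
move=> snakeM _ i /andP[i_gt0 _]; rewrite !fvec_base_polytope.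
exact: card_faces_log_concave.
Qed.
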